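(* Let $g_j\in\mathbb{R}[\mathbf{x}]_{d_j}$ and $s_j:=\lceil\deg(g_j)/2\rceil$ for $j=0,\ldots,m$, and for every $t\ge\max_j s_j$ let $\mathbf{K}_t\subset\mathbb{R}[\mathbf{x}]$ be the convex cone $$\mathbf{K}_t:=\Big\{\sum_{j=0}^m\sigma_j(\mathbf{x})\,g_j(\mathbf{x})\;:\;\sigma_j\in\Sigma_{t-s_j},\ j=0,\ldots,m\Big\}\subset\mathbb{R}[\mathbf{x}]_{2t}.$$ If $p\in\mathrm{int}(\mathbf{K}_t)$ then $p\ge0$ on $S:=\{\mathbf{x}\in\mathbb{R}^n:g_j(\mathbf{x})\ge0,\ j=0,\ldots,m\}$ and $$p(\mathbf{x})=\sum_{j=0}^m\Lambda^{g_j\cdot\boldsymbol{\phi}}_{t-s_j}(\mathbf{x})^{-1}\,g_j(\mathbf{x})\,,\qquad\forall\,\mathbf{x}\in\mathbb{R}^n,$$ for some linear functional $\boldsymbol{\phi}=(\phi_{\boldsymbol{\alpha}})_{\boldsymbol{\alpha}\in\mathbb{N}^n_{2t}}$ that satisfies $\mathbf{M}_{t-s_j}(g_j\cdot\boldsymbol{\phi})\succ0$ for all $j=0,\ldots,m$.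
   Context: Let $\mathbb{N}^n_t=\{\boldsymbol{\alpha}\in\mathbb{N}^n:|\boldsymbol{\alpha}|\le t\}$, let $\mathbb{R}[\mathbf{x}]_{t}$ be the space of real polynomials in $\mathbf{x}=(x_1,\ldots,x_n)$ of total degree at most $t$, and $\mathbf{v}_t(\mathbf{x})=(\mathbf{x}^{\boldsymbol{\alpha}})_{\boldsymbol{\alpha}\in\mathbb{N}^n_t}$. $\Sigma_t\subset\mathbb{R}[\mathbf{x}]_{2t}$ is the convex cone of polynomials of degree at most $2t$ that are sums of squares of polynomials. The interior of $\mathbf{K}_t$ is taken in $\mathbb{R}[\mathbf{x}]_{2t}$. A real sequence $\boldsymbol{\phi}=(\phi_{\boldsymbol{\alpha}})_{\boldsymbol{\alpha}\in\mathbb{N}^n_{2t}}$ is identified with the linear functional $\mathbf{x}^{\boldsymbol{\alpha}}\mapsto\phi_{\boldsymbol{\alpha}}$ on $\mathbb{R}[\mathbf{x}]_{2t}$. Writing $g_j=\sum_{\boldsymbol{\beta}\in\mathbb{N}^n_{d_j}}g_{j\boldsymbol{\beta}}\mathbf{x}^{\boldsymbol{\beta}}$, the sequence $g_j\cdot\boldsymbol{\phi}$ is defined by $(g_j\cdot\boldsymbol{\phi})_{\boldsymbol{\alpha}}=\sum_{\boldsymbol{\beta}\in\mathbb{N}^n_{d_j}}g_{j\boldsymbol{\beta}}\,\phi_{\boldsymbol{\alpha}+\boldsymbol{\beta}}$ (for $|\boldsymbol{\alpha}|\le 2(t-s_j)$ this involves only entries of $\boldsymbol{\phi}$ with index in $\mathbb{N}^n_{2t}$).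 For a sequence $\boldsymbol{\psi}$, the moment matrix $\mathbf{M}_r(\boldsymbol{\psi})$ is indexed by $\mathbb{N}^n_r$ with entries $\mathbf{M}_r(\boldsymbol{\psi})(\boldsymbol{\alpha},\boldsymbol{\beta})=\psi_{\boldsymbol{\alpha}+\boldsymbol{\beta}}$; $\succ0$ means positive definite. When $\mathbf{M}_r(\boldsymbol{\psi})\succ0$, the Christoffel function is $\Lambda^{\boldsymbol{\psi}}_r(\mathbf{x})=[\mathbf{v}_r(\mathbf{x})^T\mathbf{M}_r(\boldsymbol{\psi})^{-1}\mathbf{v}_r(\mathbf{x})]^{-1}$.
   Formalization: The representation of p by Christoffel functions is proved assuming every g_j is nonzero and K_t contains no line (q, -q in K_t imply q = 0); without this it fails, e.g. g_0 = 1, g_1 = -1. Both conditions are necessary for such a φ; p ≥ 0 on S is proved without them. *)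

(* Defs.v *)
From HB Require Import structures.
From mathcomp Require Import all_boot all_order all_algebra.
From mathcomp Require Import boolp classical_sets reals topology normedtype.
(* The notations of mpoly clash with those of classical_sets, so only the    *)
(* constants are used: [mpoly n R] is the polynomial ring in n variables,    *)
(* [multinom n] is N^n, [bmultinom n k] is {alpha in N^n : |alpha| < k},     *)
(* [mmeasure mdeg p] is 1 + deg p, and 0 for p = 0.                          *)
From mathcomp Require Import -(notations) mpoly.

Set Implicit Arguments.
Unset Strict Implicit.
Unset Printing Implicit Defensive.
Import Order.TTheory GRing.Theory Num.Theory.
Import numFieldNormedType.Exports.
Local Open Scope classical_set_scope.
Local Open Scope ring_scope.

Definition deg_le (R : realType) (n k : nat) (p : mpoly n R) : Prop :=
  (mmeasure mdeg p <= k.+1)%N.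

(* s = ceil (deg g / 2); deg 0 is read as 0 *)
Definition half_deg (R : realType) (n : nat) (g : mpoly n R) : nat :=
  uphalf (mmeasure mdeg g).-1.

(* the cone Sigma_t *)
Definition sos (R : realType) (n t : nat) : set (mpoly n R) :=
  [set sigma | deg_le (2 * t) sigma /\
     exists s : seq (mpoly n R), sigma = \sum_(q <- s) q ^+ 2].

(* the cone K_t *)
Definition qcone (R : realType) (n m : nat) (g : 'I_m.+1 -> mpoly n R)
    (t : nat) : set (mpoly n R) :=
  [set p | exists sigma : 'I_m.+1 -> mpoly n R,
     (forall j, sos (t - half_deg (g j)) (sigma j)) /\
     p = \sum_j sigma j * g j].

Definition pointed (R : realType) (n : nat) (K : set (mpoly n R)) : Prop :=
  forall q, K q -> K (- q) -> q = 0.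

(* number of multi-indices in N^n_k, i.e. the dimension of R[x]_k *)
Definition nmon (n k : nat) : nat := #|{: bmultinom n k.+1}|.

(* the i-th multi-index of N^n_k *)
Definition mon (n k : nat) (i : 'I_(nmon n k)) : multinom n :=
  bmnm (enum_val i).

(* the linear isomorphism R^N -> R[x]_k given by the monomial basis *)
Definition poly_of_coefs (R : realType) (n k : nat) (c : 'rV[R]_(nmon n k)) :
    mpoly n R :=
  \sum_i c 0 i *: mpolyX R (mon i).

(* interior of K in R[x]_k, whose topology is that of R^N transported along  *)
(* the isomorphism above                                                     *)
Definition interior_deg (R : realType) (n k : nat) (K : set (mpoly n R)) :
    set (mpoly n R) :=
  @poly_of_coefs R n k @`
    interior ((@poly_of_coefs R n k @^-1` K) : set 'rV[R]_(nmon n k)).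

(* A functional on R[x]_k is the sequence of its values on the monomials     *)
(* x^alpha, |alpha| <= k; the sequence is extended by 0 so that              *)
(* phi_(alpha + beta) is defined for all alpha and beta.                     *)
Definition seq_ext (R : realType) (n k : nat) (phi : bmultinom n k.+1 -> R) :
    multinom n -> R :=
  fun a => oapp phi 0 (insub a).

(* the sequence g . psi, for g of degree at most d *)
Definition loc_seq (R : realType) (n d : nat) (g : mpoly n R)
    (psi : multinom n -> R) : multinom n -> R :=
  fun a => \sum_(b : bmultinom n d.+1)
             mcoeff (bmnm b) g * psi (mnm_add a (bmnm b)).

Definition moment_mx (R : realType) (n r : nat) (psi : multinom n -> R) :
    'M[R]_(nmon n r) :=
  \matrix_(i, j) psi (mnm_add (mon i) (mon j)).

Definition posdef (R : realType) (N : nat) (A : 'M[R]_N) : Prop :=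
  A^T = A /\ forall u : 'cV[R]_N, u != 0 -> 0 < (u^T *m A *m u) 0 0.

(* the vector v_r(x) of monomials of degree at most r *)
Definition mon_vec (R : realType) (n r : nat) (x : 'I_n -> R) :
    'cV[R]_(nmon n r) :=
  \col_i meval x (mpolyX R (mon i)).

Definition christoffel (R : realType) (n r : nat) (psi : multinom n -> R)
    (x : 'I_n -> R) : R :=
  (((mon_vec r x)^T *m invmx (moment_mx r psi) *m mon_vec r x) 0 0)^-1.

(* Main.v *)
Require Import Defs.
From HB Require Import structures.
From mathcomp Require Import all_boot all_order all_algebra.
From mathcomp Require Import ring lra zify.
From mathcomp Require Import boolp classical_sets reals topology normedtype.
From mathcomp Require Import derive.
From mathcomp Require Import -(notations) mpoly.

Set Implicit Arguments.
Unset Strict Implicit.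
Unset Printing Implicit Defensive.
Import Order.TTheory GRing.Theory Num.Theory.
Import numFieldNormedType.Exports.
Local Open Scope classical_set_scope.
Local Open Scope ring_scope.

(* Put M_j = M_{t-s_j}(g_j . phi), and let A be the map
   (Q_j) |-> sum_j (v^T Q_j v) g_j, adjoint to phi |-> (M_j), so that K_t is the
   image under A of the positive semidefinite families.  Pointedness makes A
   nonzero on the compact convex set of such families of total trace 1, and
   separating its image from 0 gives some phi with all M_j positive definite.
   The set {phi : M_j >= 0 for all j, phi(p) = 1} is compact because p is
   interior to K_t.  At a maximizer of (prod_j det M_j)^2 the derivative in
   every direction psi with psi(p) = 0 vanishes; as the logarithmic derivative
   of the determinant is psi(A(M_j^-1)), this says that A(M_j^-1) is
   proportional to p, and rescaling phi makes them equal.  The family (M_j) is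
   handled as one block diagonal matrix. *)

(** * Positive semidefinite matrices and their rank one decompositions *)

Definition psd (R : realType) (N : nat) (A : 'M[R]_N) : Prop :=
  A^T = A /\ forall u : 'cV[R]_N, 0 <= (u^T *m A *m u) 0 0.

Section PSD.
Variables (R : realType) (N : nat).
Implicit Types (M Q : 'M[R]_N) (u v : 'cV[R]_N).

Lemma qformE M u : (u^T *m M *m u) 0 0 = \sum_i \sum_j u i 0 * M i j * u j 0.
Proof.
rewrite mxE exchange_big /=; apply: eq_bigr => j _.
by rewrite mxE big_distrl /=; apply: eq_bigr => i _; rewrite mxE.
Qed.

Lemma mx11_tr (a : 'M[R]_1) : a^T = a.
Proof. by apply/matrixP => i j; rewrite mxE !ord1. Qed.

Lemma qformZ M u a : ((a *: u)^T *m M *m (a *: u)) 0 0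
  = a ^+ 2 * (u^T *m M *m u) 0 0.
Proof. by rewrite -scalemxAr linearZ /= -!scalemxAl scalerA mxE expr2. Qed.

Lemma qformD M u v : M^T = M ->
  ((u + v)^T *m M *m (u + v)) 0 0 =
  (u^T *m M *m u) 0 0 + (u^T *m M *m v) 0 0 *+ 2 + (v^T *m M *m v) 0 0.
Proof.
move=> sM; rewrite [(u + v)^T]linearD /= !mulmxDl !mulmxDr.
have -> : (u^T *m M *m v) = (v^T *m M *m u).
  by rewrite -[LHS]mx11_tr !trmx_mul sM trmxK mulmxA.
by rewrite [LHS]mxE [X in X + _]mxE [X in _ + X]mxE mulr2n !addrA.
Qed.

Lemma mxtrace_mul_rank1 M u : \tr (M *m (u *m u^T)) = (u^T *m M *m u) 0 0.
Proof. by rewrite mulmxA mxtrace_mulC /mxtrace big_ord1 mulmxA. Qed.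

Lemma sqnorm_rank1 u v : (u^T *m (v *m v^T) *m u) 0 0 = ((v^T *m u) 0 0) ^+ 2.
Proof.
rewrite mulmxA -mulmxA mxE big_ord1 expr2; congr (_ * _).
by rewrite -[v^T *m u]mx11_tr trmx_mul trmxK.
Qed.

Lemma psd_rank1 u : psd (u *m u^T).
Proof.
split; first by rewrite trmx_mul trmxK.
by move=> v; rewrite sqnorm_rank1 sqr_ge0.
Qed.

Lemma psd0 : psd (0 : 'M[R]_N).
Proof. by split=> [|u]; rewrite ?trmx0 // mulmx0 mul0mx mxE. Qed.

Lemma psdD M Q : psd M -> psd Q -> psd (M + Q).
Proof.
move=> [sM M0] [sQ Q0]; split; first by rewrite linearD /= sM sQ.
by move=> u; rewrite mulmxDr mulmxDl mxE addr_ge0.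
Qed.

Lemma psdZ M a : 0 <= a -> psd M -> psd (a *: M).
Proof.
move=> a0 [sM M0]; split; first by rewrite linearZ /= sM.
by move=> u; rewrite -scalemxAr -scalemxAl mxE mulr_ge0.
Qed.

Lemma psd1 : psd (1%:M : 'M[R]_N).
Proof.
split=> [|u]; first exact: trmx1.
by rewrite mulmx1 mxE sumr_ge0 // => i _; rewrite !mxE -expr2 sqr_ge0.
Qed.

Lemma qform_delta M i j :
  ((delta_mx i 0 : 'cV_N)^T *m M *m (delta_mx j 0 : 'cV_N)) 0 0 = M i j.
Proof. by rewrite trmx_delta -rowE -colE !mxE. Qed.

Lemma psd_diag_ge0 M i : psd M -> 0 <= M i i.
Proof. by move=> [_ /(_ (delta_mx i 0))]; rewrite qform_delta. Qed.

(** With [M i i = 0] the form at [a e_i + e_j] is affine in [a] with slope [2 M i j]; if the slope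
    is nonzero, the chosen [a] gives the value -1. *)
Lemma psd_diag_eq0 M i j : psd M -> M i i = 0 -> M i j = 0.
Proof.
move=> pM Mi0; have [sM M0] := pM; apply/eqP/negP => /negP Mij.
pose a := - (M j j + 1) / (M i j *+ 2).
have := M0 (a *: delta_mx i 0 + delta_mx j 0).
rewrite qformD // qformZ !qform_delta Mi0 mulr0 add0r.
rewrite linearZ /= -!scalemxAl mxE qform_delta.
have -> : (a * M i j) *+ 2 = - (M j j + 1).
  by rewrite /a; field.
by lra.
Qed.

(* Each step passes to the Schur complement of a nonzero diagonal entry, which
   differs by a rank one matrix. *)
Lemma psd_sum_rank1 Q : psd Q ->
  exists s : seq 'cV[R]_N, Q = \sum_(u <- s) u *m u^T.
Proof.
have [k] := ubnP #|[pred i | Q i i != 0]|; elim: k Q => // k IH Q.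
rewrite ltnS => cQ pQ; have [sQ Q0] := pQ.
have [i /= Qi|Q_diag] := pickP [pred i | Q i i != 0]; last first.
  exists [::]; rewrite big_nil; apply/matrixP => i j; rewrite mxE.
  by apply: psd_diag_eq0 => //; have /= /negbFE/eqP := Q_diag i.
have d_gt0 : 0 < Q i i by rewrite lt_def Qi psd_diag_ge0.
set d := Q i i in Qi d_gt0.
pose v := (Num.sqrt d)^-1 *: col i Q.
have vE j l : (v *m v^T) j l = Q j i * Q l i / d.
  rewrite mxE big_ord1 !mxE mulrACA -invfM -expr2 sqr_sqrtr ?ltW //.
  by rewrite mulrC.
have pQ' : psd (Q - v *m v^T).
  split; first by rewrite linearB /= sQ trmx_mul trmxK.
  move=> u; rewrite mulmxBr mulmxBl [leRHS]mxE [X in _ + X]mxE sqnorm_rank1.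
  (* This [c] minimizes the form of [Q] at [c e_i + u], and the minimum is the form of the Schur
     complement at [u]. *)
  pose c := - ((delta_mx i 0 : 'cV_N)^T *m Q *m u) 0 0 / d.
  have := Q0 (c *: delta_mx i 0 + u).
  have cE : ((c *: delta_mx i 0 : 'cV_N)^T *m Q *m u) 0 0 =
      c * ((delta_mx i 0 : 'cV_N)^T *m Q *m u) 0 0.
    by rewrite linearZ /= -!scalemxAl mxE.
  rewrite qformD // qformZ !qform_delta cE.
  have -> : ((v^T *m u) 0 0) ^+ 2 =
      d^-1 * ((delta_mx i 0 : 'cV_N)^T *m Q *m u) 0 0 ^+ 2.
    rewrite /v linearZ /= -scalemxAl mxE exprMn exprVn sqr_sqrtr ?ltW //.
    by rewrite trmx_delta -rowE tr_col sQ.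
  rewrite /c -/d.
  move: (((delta_mx i 0 : 'cV_N)^T *m Q *m u) 0 0) => b.
  have -> : (- b / d) ^+ 2 * d + (- b / d * b) *+ 2 = - (d^-1 * b ^+ 2).
    by field.
  by rewrite addrC.
(* Zero diagonal entries of [Q] stay zero, as their rows vanish, and the entry at [i] becomes zero,
   so the count drops. *)
have dE j : (Q - v *m v^T) j j = Q j j - Q j i * Q j i / d.
  by rewrite mxE [X in _ + X]mxE vE.
have [|s sE] := IH _ _ pQ'.
  apply: leq_trans cQ; apply: proper_card; apply/properP; split.
    apply/fintype.subsetP => j; rewrite !inE dE.
    apply: contraNN => /eqP Qj; rewrite Qj (psd_diag_eq0 i pQ Qj).
    by rewrite !mul0r subr0.
  exists i; rewrite !inE // dE -/d.
  by rewrite mulfK // subrr eqxx.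
by exists (v :: s); rewrite big_cons -sE addrCA subrr addr0.
Qed.

(** In a rank one term, [(u_i^2 + u_j^2) / 2] dominates the absolute value of [u_i u_j] and is at
    most the trace; the terms add up. *)
Lemma psd_entry_le Q i j : psd Q -> `|Q i j| <= \tr Q.
Proof.
move=> /psd_sum_rank1[s ->]; rewrite summxE linear_sum /=.
apply: le_trans (ler_norm_sum _ _ _) _; apply: ler_sum => u _.
rewrite mxE big_ord1 [u^T _ _]mxE.
have trE : \tr (u *m u^T) = \sum_k u k 0 ^+ 2.
  by apply: eq_bigr => k _; rewrite mxE big_ord1 mxE expr2.
have le_tr k : u k 0 ^+ 2 <= \tr (u *m u^T).
  by rewrite trE (bigD1 k) //= lerDl sumr_ge0 // => l _; exact: sqr_ge0.
have := le_tr i; have := le_tr j.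
rewrite ler_norml; have := sqr_ge0 (u i 0 - u j 0).
have := sqr_ge0 (u i 0 + u j 0); move: (u i 0) (u j 0) (\tr _) => a b c.
by move=> *; apply/andP; split; nra.
Qed.

Lemma psd_tr_ge0 Q : psd Q -> 0 <= \tr Q.
Proof. by move=> pQ; apply: sumr_ge0 => i _; exact: psd_diag_ge0. Qed.

Lemma psd_tr_eq0 Q : psd Q -> \tr Q = 0 -> Q = 0.
Proof.
move=> pQ t0; apply/matrixP => i j; rewrite mxE; apply/eqP.
by rewrite -normr_le0 -t0 psd_entry_le.
Qed.

Lemma psd_tr_mul_ge0 M Q : psd M -> psd Q -> 0 <= \tr (M *m Q).
Proof.
move=> [_ M0] /psd_sum_rank1[s ->]; rewrite mulmx_sumr linear_sum /=.
by apply: sumr_ge0 => u _; rewrite mxtrace_mul_rank1.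
Qed.

Lemma posdef_psd M : posdef M -> psd M.
Proof.
move=> [sM M0]; split=> // u; have [->|/M0/ltW//] := eqVneq u 0.
by rewrite mulmx0 mxE.
Qed.

(** Splitting [Q] into rank one terms turns the trace into a sum of values of the form of [M], which
    is zero only if every vector of the splitting is. *)
Lemma posdef_tr_mul_gt0 M Q : posdef M -> psd Q -> Q != 0 -> 0 < \tr (M *m Q).
Proof.
move=> pM pQ Qn0.
rewrite lt_def psd_tr_mul_ge0 ?andbT //; last exact: posdef_psd.
apply: contraNneq Qn0; have [s ->] := psd_sum_rank1 pQ.
rewrite mulmx_sumr linear_sum /= => /eqP.
rewrite psumr_eq0 => [/allP s0|u _]; last first.
  by rewrite mxtrace_mul_rank1; exact: (posdef_psd pM).2.
rewrite big_seq big1 // => u /s0 /=; rewrite mxtrace_mul_rank1.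
have [->|/(pM.2) h /eqP h0] := eqVneq u 0; first by rewrite mul0mx.
by rewrite h0 ltxx in h.
Qed.

(** Writing [M] as a sum of terms [v *m v^T], a zero of the form is orthogonal to every [v], hence
    lies in the kernel of [M]. *)
Lemma psd_unit_posdef M : psd M -> M \in unitmx -> posdef M.
Proof.
move=> pM uM; have [sM M0] := pM; split=> // u un0; rewrite lt_def M0 andbT.
apply: contraNneq un0; have [s sE] := psd_sum_rank1 pM.
rewrite -mxtrace_mul_rank1 {1}sE mulmx_suml linear_sum /= => /eqP.
rewrite psumr_eq0 => [/allP s0|v _]; last first.
  by rewrite mxtrace_mul_rank1; exact: (psd_rank1 v).2.
suff Mu0 : M *m u = 0 by rewrite -[u]mul1mx -(mulVmx uM) -mulmxA Mu0 mulmx0.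
rewrite sE mulmx_suml big_seq big1 // => v /s0 /=.
rewrite mxtrace_mul_rank1 sqnorm_rank1 sqrf_eq0 => /eqP vu.
rewrite -mulmxA [_ *m u](_ : _ = 0) ?mulmx0 //.
by apply/matrixP => i j; rewrite !ord1 vu mxE.
Qed.

Lemma posdef_unit M : posdef M -> M \in unitmx.
Proof.
move=> [sM M0]; rewrite unitmxE unitfE; apply/negP => /det0P[v vn0 vM].
have : v^T != 0 by rewrite trmx_eq0.
by move/M0; rewrite trmxK vM mul0mx mxE ltxx.
Qed.

End PSD.

(** * Continuity, closedness and compactness for positive semidefinite matrices *)

Section Topology.
Variable R : realType.

Lemma continuous_sumr (T : topologicalType) (I : Type) (r : seq I) (P : pred I)
    (F : I -> T -> R) :
  (forall i, P i -> continuous (F i)) ->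
  continuous (fun x => \sum_(i <- r | P i) F i x).
Proof. by move=> cF; apply: continuous_big => //; exact: add_continuous. Qed.

Lemma continuous_prodr (T : topologicalType) (I : Type) (r : seq I) (P : pred I)
    (F : I -> T -> R) :
  (forall i, P i -> continuous (F i)) ->
  continuous (fun x => \prod_(i <- r | P i) F i x).
Proof. by move=> cF; apply: continuous_big => //; exact: mul_continuous. Qed.

Lemma continuous_mulr (T : topologicalType) (f h : T -> R) :
  continuous f -> continuous h -> continuous (fun x => f x * h x).
Proof. by move=> cf ch x; apply: cvgM; [exact: cf|exact: ch]. Qed.

Lemma continuous_det (T : topologicalType) N (F : T -> 'M[R]_N) :
  (forall i j, continuous (fun x => F x i j)) ->
  continuous (fun x => \det (F x)).
Proof.
move=> cF; apply: continuous_sumr => s _; apply: continuous_mulr => [x|].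
  exact: cvg_cst.
by apply: continuous_prodr => i _; exact: cF.
Qed.

Lemma closed_psd (T : topologicalType) N (F : T -> 'M[R]_N) :
  (forall i j, continuous (fun x => F x i j)) -> closed [set x | psd (F x)].
Proof.
move=> cF.
have -> : [set x | psd (F x)] =
    \bigcap_(k in [set: 'I_N * 'I_N])
      [set x | F x k.1 k.2 - F x k.2 k.1 = 0] `&`
    \bigcap_(u in [set: 'cV[R]_N]) [set x | 0 <= (u^T *m F x *m u) 0 0].
  apply/seteqP; split=> x /=.
    move=> [sF F0]; split=> [[i j] _ /=|u _]; last exact: F0.
    by rewrite -{1}sF mxE subrr.
  move=> [sF F0]; split=> [|u]; last exact: (F0 u I).
  apply/matrixP => i j; rewrite mxE; apply/eqP.
  by rewrite -subr_eq0; apply/eqP/(sF (j, i)).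
apply: closedI; apply: closed_bigI; [move=> [i j] _ /=|move=> u _ /=].
  apply: (@closed_comp _ _ (fun x => F x i j - F x j i) [set 0]).
    by move=> x _; apply: cvgB; exact: cF.
  exact: closed_eq.
apply: (@closed_comp _ _ (fun x => (u^T *m F x *m u) 0 0) [set y | 0 <= y]).
  move=> x _; have -> : (fun x => (u^T *m F x *m u) 0 0) =
     (fun x => \sum_i \sum_j u i 0 * F x i j * u j 0).
    by apply/funext => y; rewrite qformE.
  apply: continuous_sumr => i _; apply: continuous_sumr => j _.
  apply: continuous_mulr => [|y]; last exact: cvg_cst.
  by apply: continuous_mulr => [y|]; [exact: cvg_cst|exact: cF].
exact: closed_ge.
Qed.

Lemma closed_coord_bounded_compact n (C : set 'rV[R]_n) (c : R) :
  (forall x, C x -> forall k, `|x 0 k| <= c) -> closed C -> compact C.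
Proof.
move=> Cc clC.
have cB : compact [set v : 'rV[R]_n | forall i, v 0 i \in `[(- c), c]].
  apply: (@rV_compact _ _ (fun=> `[(- c), c]%classic)) => _.
  exact: segment_compact.
apply: subclosed_compact clC cB _ => x /Cc xc i.
by rewrite in_itv /= -ler_norml.
Qed.

(** A compact base of the positive semidefinite cone; flattening to row vectors gives access to the
    compactness of boxes. *)
Definition gram_base N : set 'rV[R]_(N * N) :=
  [set x | psd (vec_mx x) /\ \tr (vec_mx x) = 1].

Lemma continuous_vec_mx N i j :
  continuous (fun x : 'rV[R]_(N * N) => vec_mx x i j).
Proof.
have -> : (fun x : 'rV[R]_(N * N) => vec_mx x i j) =
    (fun x => x 0 (mxvec_index i j)).
  by apply/funext => x; rewrite mxE.
exact: coord_continuous.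
Qed.

Lemma compact_gram_base N : compact (@gram_base N).
Proof.
apply: (@closed_coord_bounded_compact _ _ 1).
  move=> x [px t1] k; case/mxvec_indexP: k => i j.
  have -> : x 0 (mxvec_index i j) = vec_mx x i j by rewrite mxE.
  by rewrite -[leRHS]t1 psd_entry_le.
apply: closedI; first exact: (closed_psd (@continuous_vec_mx N)).
apply: (@closed_comp _ _ (fun x : 'rV[R]_(N * N) => \tr (vec_mx x)) [set 1]).
  by move=> x _; apply: continuous_sumr => i _; exact: continuous_vec_mx.
exact: closed_eq.
Qed.

Lemma gram_base_rank1 N (u : 'cV[R]_N) : u != 0 ->
  exists2 a, 0 < a & gram_base (mxvec (a *: (u *m u^T))).
Proof.
move=> un0; have t_gt0 : 0 < \tr (u *m u^T).
  rewrite lt_def psd_tr_ge0 ?andbT; last exact: psd_rank1.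
  apply: contraNneq un0 => /(psd_tr_eq0 (psd_rank1 u))/matrixP uu.
  apply/eqP/matrixP => i j; rewrite !ord1 mxE.
  have := uu i i; rewrite mxE big_ord1 !mxE => /eqP.
  by rewrite mulf_eq0 orbb => /eqP.
exists (\tr (u *m u^T))^-1; first by rewrite invr_gt0.
split; rewrite mxvecK.
  by apply: psdZ; [rewrite invr_ge0 ltW|exact: psd_rank1].
by rewrite mxtraceZ mulVf // gt_eqF.
Qed.

(** The base contains a positive multiple of each [u *m u^T] with [u != 0], and pairing with it
    gives the same multiple of the form at [u]. *)
Lemma posdef_on_gram_base N (M : 'M[R]_N) : M^T = M ->
  (forall x, gram_base x -> 0 < \tr (M *m vec_mx x)) -> posdef M.
Proof.
move=> sM MT; split=> // u /gram_base_rank1[a a0 /MT].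
by rewrite mxvecK -scalemxAr mxtraceZ mxtrace_mul_rank1 pmulr_rgt0.
Qed.

(** Pairing with [M] has a positive minimum [c] on the compact base, while pairing with [H] is
    bounded there by [h], the sum of the absolute values of its entries. *)
Lemma posdef_perturb N (M H : 'M[R]_N) : posdef M -> H^T = H ->
  exists2 e, 0 < e & forall s, `|s| < e -> psd (M + s *: H).
Proof.
move=> pM sH.
(* The extreme value theorem requires a nonempty base; on an empty one the criterion holds
   vacuously. *)
have [[x0 Tx0]|T0] := pselect (exists x, @gram_base N x); last first.
  exists 1 => // s _; apply: posdef_psd; apply: posdef_on_gram_base.
    by rewrite linearD linearZ /= pM.1 sH.
  by move=> x Tx; case: T0; exists x.
have [||x /set_mem Tx xmin] :=
    @compact_EVT_min _ _ (fun x => \tr (M *m vec_mx x)) _ _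
      (@compact_gram_base N).
  by exists x0.
  apply: continuous_subspaceT => y; apply: continuous_sumr => i _.
  have -> : (fun x : 'rV[R]_(N * N) => (M *m vec_mx x) i i) =
      (fun x => \sum_j M i j * vec_mx x j i) by apply/funext => x; rewrite mxE.
  apply: continuous_sumr => j _.
  apply: (@continuous_mulr _ (fun=> M i j)); last exact: continuous_vec_mx.
  exact: cst_continuous.
set c := \tr _ in xmin.
have c_gt0 : 0 < c.
  apply: posdef_tr_mul_gt0 => //; first by case: Tx.
  case: Tx => _; apply: contra_eqN => /eqP ->.
  by rewrite mxtrace0 eq_sym oner_eq0.
pose h := \sum_i \sum_j `|H i j|.
have h_ge0 : 0 <= h by apply: sumr_ge0 => i _; apply: sumr_ge0 => j _.
(* Adding 1 keeps the denominator positive when [H = 0]. *)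
exists (c / (h + 1)); first by rewrite divr_gt0 // ltr_wpDl.
move=> s; rewrite ltr_pdivlMr ?ltr_wpDl // => sc.
apply: posdef_psd; apply: posdef_on_gram_base.
  by rewrite linearD linearZ /= pM.1 sH.
move=> y Ty; rewrite mulmxDl linearD /= -scalemxAl mxtraceZ.
have cy : c <= \tr (M *m vec_mx y) by apply: xmin; rewrite inE.
have hy : `|\tr (H *m vec_mx y)| <= h.
  apply: le_trans (ler_norm_sum _ _ _) _; apply: ler_sum => i _.
  rewrite mxE; apply: le_trans (ler_norm_sum _ _ _) _; apply: ler_sum => j _.
  by rewrite normrM ler_piMr // -[leRHS](proj2 Ty) psd_entry_le //; case: Ty.
have : `|s * \tr (H *m vec_mx y)| <= `|s| * h by rewrite normrM ler_wpM2l.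
rewrite ler_norml => /andP[lo _]; have := normr_ge0 s.
by move: (`|s|) sc lo => a; nra.
Qed.

End Topology.

(** * First-order optimality through polynomials in one variable *)

Section FirstOrder.
Variable R : realType.

Lemma horner_char_poly N (A : 'M[R]_N) x : (char_poly A).[x] = \det (x%:M - A).
Proof.
rewrite -horner_evalE -det_map_mx; congr (\det _).
apply/matrixP => i j; rewrite !mxE /= /horner_eval hornerD hornerN hornerC.
by case: (i == j); rewrite ?mulr1n ?mulr0n ?hornerX ?horner0.
Qed.

(* [P] is the reversal of the characteristic polynomial of [- X]. *)
Lemma det_add1_scale_poly N (X : 'M[R]_N) : (0 < N)%N ->
  exists P : {poly R}, [/\ forall s, P.[s] = \det (1%:M + s *: X),
    P`_0 = 1 & P`_1 = \tr X].
Proof.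
move=> N0; pose chi := char_poly (- X).
have chiN : chi`_N = 1.
  by have /monicP := char_poly_monic (- X); rewrite lead_coefE size_char_poly.
have chiN1 : chi`_N.-1 = \tr X.
  by rewrite char_poly_trace // linearN opprK.
exists (\poly_(i < N.+1) chi`_(N - i)); split; last 2 first.
- by rewrite coef_poly subn0.
- by rewrite coef_poly ltnS N0 subn1.
(* The identity [det (1 + s X) = s^N chi(1/s)] requires [s != 0], so [s = 0] is checked
   separately. *)
move=> s; rewrite horner_poly; have [->|s0] := eqVneq s 0.
  rewrite scale0r addr0 det1 big_ord_recl subn0 chiN expr0 mulr1.
  by rewrite big1 ?addr0 // => i _; rewrite exprS mul0r mulr0.
rewrite (reindex_inj rev_ord_inj) /=.
have -> : 1%:M + s *: X = s *: (s^-1%:M - - X).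
  by rewrite opprK scalerDr scale_scalar_mx mulfV.
rewrite detZ -horner_char_poly horner_coef size_char_poly mulr_sumr.
apply: eq_bigr => i _; have iN : (i <= N)%N by rewrite -ltnS.
rewrite subSS subKn // mulrCA; congr (_ * _).
apply: (mulIf (expf_neq0 i s0)).
by rewrite -exprD subnK // -mulrA -exprMn mulVf // expr1n mulr1.
Qed.

(** [W] is nonpositive just to the right of 0 and nonnegative just to the left, so continuity leaves
    only the value 0. *)
Lemma horner0_eq0_of_sign (W : {poly R}) e : 0 < e ->
  (forall s, `|s| < e -> s * W.[s] <= 0) -> W.[0] = 0.
Proof.
move=> e0 We; apply/eqP/negP => /negP W0.
have /cvgrPdist_lt /(_ `|W.[0]|) := @continuous_horner R W 0.
rewrite normr_gt0 => /(_ W0) /nbhs_ballP[r /= r0 Wr].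
(* Both [s] and [- s] lie within the radius [e] of the sign condition and the radius [r] on which
   [W] keeps the sign of [W.[0]]. *)
pose s := Num.min e r / 2.
have m0 : 0 < Num.min e r by rewrite lt_min e0.
have s0 : 0 < s by rewrite divr_gt0.
have sm : s < Num.min e r by rewrite /s; lra.
have [se sr] : s < e /\ s < r by move: sm; rewrite lt_min => /andP[].
have Wp : `|W.[0] - W.[s]| < `|W.[0]|.
  by apply: Wr; rewrite /ball /= sub0r normrN gtr0_norm.
have Wn : `|W.[0] - W.[- s]| < `|W.[0]|.
  by apply: Wr; rewrite /ball /= sub0r opprK gtr0_norm.
have := We s; rewrite gtr0_norm // => /(_ se); rewrite pmulr_rle0 // => Ws.
have := We (- s); rewrite normrN gtr0_norm // => /(_ se).
rewrite mulNr oppr_le0 pmulr_rge0 // => WNs.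
move: Wp Wn.
case: (ltrgtP W.[0] 0) => [W0n|W0p|W00]; last by rewrite W00 eqxx in W0.
- by rewrite (ltr0_norm W0n) !ltr_norml => /andP[? ?] /andP[? ?]; lra.
- by rewrite (gtr0_norm W0p) !ltr_norml => /andP[? ?] /andP[? ?]; lra.
Qed.

(** Writing [P = 1 + X Q] gives [P^2 - 1 = X W] with [W = Q (2 + X Q)]; the sign of [s W(s)] forces
    [W(0) = 2 P_1] to vanish. *)
Lemma coef1_eq0_of_local_max (P : {poly R}) e : 0 < e -> P`_0 = 1 ->
  (forall s, `|s| < e -> P.[s] ^+ 2 <= 1) -> P`_1 = 0.
Proof.
elim/poly_ind: P => [|Q c _]; first by rewrite !coef0.
move=> e0; rewrite coefD coefMX coefC /= add0r => c1.
rewrite coefD coefMX !coefC /= addr0 -horner_coef0 => Ple.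
have : (Q * (2%:P + Q * 'X)).[0] = 0.
  apply: (horner0_eq0_of_sign e0) => s /Ple.
  rewrite !hornerE c1 /=; move: Q.[s] => q.
  by rewrite expr2 => h; nra.
by rewrite !hornerE /= => /eqP; rewrite mulf_eq0 pnatr_eq0 orbF => /eqP.
Qed.

End FirstOrder.

(** * The pairing of row vectors and separation from the origin *)

Section Pairing.
Variables (R : realType) (D : nat).
Implicit Types a b c : 'rV[R]_D.

Definition dotv a b : R := (a *m b^T) 0 0.

Lemma dotvE a b : dotv a b = \sum_k a 0 k * b 0 k.
Proof. by rewrite /dotv mxE; apply: eq_bigr => k _; rewrite mxE. Qed.

Lemma dotvC a b : dotv a b = dotv b a.
Proof. by rewrite !dotvE; apply: eq_bigr => k _; rewrite mulrC. Qed.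

Lemma dotvDl a b c : dotv (a + b) c = dotv a c + dotv b c.
Proof. by rewrite /dotv mulmxDl mxE. Qed.

Lemma dotvZl s a b : dotv (s *: a) b = s * dotv a b.
Proof. by rewrite /dotv -scalemxAl mxE. Qed.

Lemma dotvDr a b c : dotv a (b + c) = dotv a b + dotv a c.
Proof. by rewrite !(dotvC a) dotvDl. Qed.

Lemma dotvZr s a b : dotv a (s *: b) = s * dotv a b.
Proof. by rewrite !(dotvC a) dotvZl. Qed.

Lemma dotv_sumr (I : Type) (r : seq I) (F : I -> 'rV[R]_D) a :
  dotv a (\sum_(i <- r) F i) = \sum_(i <- r) dotv a (F i).
Proof. by rewrite /dotv linear_sum mulmx_sumr summxE. Qed.

Lemma dotv_deltal k b : dotv (delta_mx 0 k) b = b 0 k.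
Proof. by rewrite /dotv -rowE !mxE. Qed.

Lemma dotv_gt0 a : a != 0 -> 0 < dotv a a.
Proof.
move=> an0; rewrite dotvE lt_def; apply/andP; split; last first.
  by apply: sumr_ge0 => k _; rewrite -expr2 sqr_ge0.
apply: contraNneq an0 => /eqP; rewrite psumr_eq0 => [/allP h|k _]; last first.
  by rewrite -expr2 sqr_ge0.
apply/eqP/matrixP => i k; rewrite !ord1 mxE; apply/eqP.
by have := h k (mem_index_enum _); rewrite -expr2 sqrf_eq0.
Qed.

(* The point of the image nearest to the origin separates it from the origin. *)
Lemma compact_convex_separation n (C : set 'rV[R]_n)
    (f : 'rV[R]_n -> 'rV[R]_D) :
  compact C -> (forall k, continuous (fun x => f x 0 k)) ->
  (forall x y s, C x -> C y -> 0 <= s <= 1 ->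
    exists2 z, C z & f z = f x + s *: (f y - f x)) ->
  (forall x, C x -> f x != 0) ->
  exists phi, forall x, C x -> 0 < dotv phi (f x).
Proof.
move=> cC cf convC f0.
have [C0|C0] := pselect (C !=set0); last first.
  by exists 0 => x Cx; case: C0; exists x.
have [|x /set_mem Cx xmin] :=
    @compact_EVT_min _ _ (fun x => dotv (f x) (f x)) _ C0 cC.
  apply: continuous_subspaceT.
  have -> : (fun x => dotv (f x) (f x)) = (fun x => \sum_k f x 0 k * f x 0 k).
    by apply/funext => x; rewrite dotvE.
  by apply: continuous_sumr => k _; apply: continuous_mulr.
exists (f x) => y Cy; rewrite ltNge; apply/negP => le0.
have b_gt0 := dotv_gt0 (f0 _ Cx).
set b := f x in le0 b_gt0 xmin; set d := f y - b.
have bd : dotv b d <= - dotv b b.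
  by rewrite /d dotvDr -scaleN1r dotvZr mulN1r gerDr.
have d_ge0 : 0 <= dotv d d.
  by have [->|/dotv_gt0/ltW//] := eqVneq d 0; rewrite /dotv mul0mx mxE.
(* Since [dotv b d <= - dotv b b], moving from [b] by [s *: d] with this [s] strictly decreases the
   squared norm, against minimality. *)
pose s := dotv b b / (dotv b b + dotv d d).
have q0 : 0 < dotv b b + dotv d d by rewrite ltr_wpDr.
have s_gt0 : 0 < s by rewrite divr_gt0.
have sq : s * (dotv b b + dotv d d) = dotv b b by rewrite /s divfK ?gt_eqF.
have [|z Cz fz] := convC x y s Cx Cy.
  by rewrite ltW //= /s ler_pdivrMr // mul1r lerDl.
have := xmin z; rewrite inE => /(_ Cz).
rewrite fz -/b -/d dotvDl !dotvDr !dotvZl !dotvZr (dotvC d b).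
by move: (dotv b b) (dotv b d) (dotv d d) b_gt0 bd d_ge0 sq s_gt0 => *; nra.
Qed.

End Pairing.

(** * Interior points of an abstract Gram cone and determinant maximization *)

Lemma interior_rV_perturb (R : realType) n (K : set 'rV[R]_n) (p : 'rV[R]_n) :
  interior K p ->
  exists2 e, 0 < e & forall v : 'rV[R]_n, (forall k, `|v 0 k| < e) -> K (p + v).
Proof.
move=> /nbhs_ballP[e /= e0 eK]; exists e => // v ve; apply: eK.
by split=> // i k; rewrite !ord1 /ball /= mxE opprD addrA subrr sub0r normrN.
Qed.

Section SquaredFunctional.
Variables (R : realType) (N D : nat) (E : 'I_N -> 'I_N -> 'rV[R]_D).

(** [E i j] abstracts the coordinates of the product of the basis elements [i] and [j]. This is the
    map A in that generality, and [moment_map] is its adjoint. *)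
Definition gram_map (Q : 'M[R]_N) : 'rV[R]_D := \sum_i \sum_j Q i j *: E i j.

Definition moment_map (phi : 'rV[R]_D) : 'M[R]_N :=
  \matrix_(i, j) dotv phi (E i j).

Definition gram_cone : set 'rV[R]_D :=
  [set v | exists2 Q, psd Q & v = gram_map Q].

Lemma gram_mapD Q Q' : gram_map (Q + Q') = gram_map Q + gram_map Q'.
Proof.
rewrite /gram_map -big_split; apply: eq_bigr => i _ /=.
by rewrite -big_split; apply: eq_bigr => j _; rewrite mxE scalerDl.
Qed.

Lemma gram_mapZ a Q : gram_map (a *: Q) = a *: gram_map Q.
Proof.
rewrite /gram_map scaler_sumr; apply: eq_bigr => i _ /=.
by rewrite scaler_sumr; apply: eq_bigr => j _; rewrite mxE scalerA.
Qed.

Lemma moment_mapD a b : moment_map (a + b) = moment_map a + moment_map b.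
Proof. by apply/matrixP => i j; rewrite !mxE dotvDl. Qed.

Lemma moment_mapZ s a : moment_map (s *: a) = s *: moment_map a.
Proof. by apply/matrixP => i j; rewrite !mxE dotvZl. Qed.

Lemma continuous_gram_map n (F : 'rV[R]_n -> 'M[R]_N) k :
  (forall i j, continuous (fun x => F x i j)) ->
  continuous (fun x => gram_map (F x) 0 k).
Proof.
move=> cF; have -> : (fun x => gram_map (F x) 0 k) =
    (fun x => \sum_i \sum_j F x i j * E i j 0 k).
  apply/funext => x; rewrite summxE; apply: eq_bigr => i _.
  by rewrite summxE; apply: eq_bigr => j _; rewrite mxE.
apply: continuous_sumr => i _; apply: continuous_sumr => j _.
by apply: continuous_mulr; [exact: cF|exact: cst_continuous].
Qed.

Lemma continuous_dotvl (b : 'rV[R]_D) : continuous (fun a => dotv a b).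
Proof.
have -> : (fun a => dotv a b) = (fun a => \sum_k a 0 k * b 0 k).
  by apply/funext => a; rewrite dotvE.
apply: continuous_sumr => k _.
by apply: continuous_mulr; [exact: coord_continuous|exact: cst_continuous].
Qed.

Lemma continuous_moment_map i j : continuous (fun phi => moment_map phi i j).
Proof.
have -> : (fun phi => moment_map phi i j) = (fun phi => dotv phi (E i j)).
  by apply/funext => a; rewrite mxE.
exact: continuous_dotvl.
Qed.

Hypothesis symE : forall i j, E i j = E j i.

Lemma moment_map_sym phi : (moment_map phi)^T = moment_map phi.
Proof. by apply/matrixP => i j; rewrite !mxE symE. Qed.

Lemma dotv_gram_map phi Q : dotv phi (gram_map Q) = \tr (moment_map phi *m Q).
Proof.
have -> : dotv phi (gram_map Q) = \sum_i \sum_j Q i j * dotv phi (E i j).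
  rewrite dotv_sumr; apply: eq_bigr => i _; rewrite dotv_sumr.
  by apply: eq_bigr => j _; rewrite dotvZr.
rewrite exchange_big; apply: eq_bigr => i _; rewrite mxE; apply: eq_bigr => j _.
by rewrite mxE mulrC symE.
Qed.

Hypothesis gram_map_eq0 : forall Q, psd Q -> gram_map Q = 0 -> Q = 0.

(** The image of the trace-one base misses the origin by [gram_map_eq0]. A functional separating the
    two has a positive definite moment matrix by adjointness. *)
Lemma exists_posdef_moment : exists phi, posdef (moment_map phi).
Proof.
have [||x [px t1]|phi phiP] := @compact_convex_separation R D _ (@gram_base R N)
    (fun x => gram_map (vec_mx x)) (@compact_gram_base R N).
- by move=> k; apply: continuous_gram_map; exact: continuous_vec_mx.
- move=> x y s [px tx] [py ty] /andP[s0 s1].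
  exists (x + s *: (y - x)); last first.
    rewrite linearD linearZ linearB /= !(gram_mapD, gram_mapZ).
    by rewrite -scaleN1r gram_mapZ scaleN1r.
  have -> : x + s *: (y - x) = (1 - s) *: x + s *: y.
    by rewrite scalerBr scalerBl scale1r addrCA addrC.
  split; rewrite linearD !linearZ /=.
    by apply: psdD; apply: psdZ => //; rewrite subr_ge0.
  by rewrite mxtraceD !mxtraceZ tx ty !mulr1 subrK.
- apply: contra_eqN t1 => /eqP/(gram_map_eq0 px) ->.
  by rewrite mxtrace0 eq_sym oner_eq0.
exists phi; apply: posdef_on_gram_base; first exact: moment_map_sym.
by move=> x /phiP; rewrite dotv_gram_map.
Qed.

Theorem interior_gram_cone (p : 'rV[R]_D) : (0 < N)%N -> interior gram_cone p ->
  exists phi, posdef (moment_map phi) /\ gram_map (invmx (moment_map phi)) = p.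
Proof.
move=> N0 /interior_rV_perturb[e e0 pe].
have [phi0 pd0] := exists_posdef_moment.
have cone_ge0 phi v : psd (moment_map phi) -> gram_cone v -> 0 <= dotv phi v.
  by move=> pphi [Q pQ ->]; rewrite dotv_gram_map psd_tr_mul_ge0.
(* Moving from [p] slightly against [v], the image of the identity, stays in the cone, so [phi0] at
   [p] is at least a positive multiple of [phi0] at [v]. *)
have phi0p : 0 < dotv phi0 p.
  pose v : 'rV[R]_D := gram_map 1%:M.
  have [a a0 ae] : exists2 a, 0 < a & forall k, a * `|v 0 k| < e.
    pose c := \sum_k `|v 0 k|; have c0 : 0 <= c by apply: sumr_ge0.
    exists (e / (c + 1)) => [|k]; first by rewrite divr_gt0 // ltr_wpDl.
    rewrite mulrAC ltr_pdivrMr ?ltr_wpDl // ltr_pM2l //.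
    by rewrite (@le_lt_trans _ _ c) ?ltrDl // /c (bigD1 k) //= lerDl sumr_ge0.
  have : gram_cone (p + - a *: v).
    by apply: pe => k; rewrite mxE normrM normrN (gtr0_norm a0).
  move/(cone_ge0 _ _ (posdef_psd pd0)); rewrite dotvDr dotvZr.
  have : 0 < dotv phi0 v.
    rewrite /v dotv_gram_map; apply: posdef_tr_mul_gt0 => //; first exact: psd1.
    apply/eqP => /matrixP /(_ (Ordinal N0) (Ordinal N0)).
    by rewrite !mxE eqxx => /eqP; rewrite oner_eq0.
  by move: (dotv _ v) (dotv _ p) => x y; nra.
pose C := [set phi | psd (moment_map phi)] `&` [set phi | dotv phi p = 1].
have cC : compact C.
  (* A functional in [C] is 1 at [p] and nonnegative at [p + b e_k] for [b = e / 2] and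
     [b = - e / 2], which bounds its coordinate [k] by [2 / e]. *)
  apply: (@closed_coord_bounded_compact _ _ _ (2 / e)).
    move=> phi [pphi phip] k.
    have he b : `|b| < e -> gram_cone (p + b *: delta_mx 0 k).
      move=> be; apply: pe => l; rewrite !mxE eqxx /=.
      by case: (l == k); rewrite ?mulr1 // mulr0 normr0.
    have e2 : 0 < e / 2 by rewrite divr_gt0.
    have e2e : `|e / 2| < e by rewrite gtr0_norm //; lra.
    have := cone_ge0 _ _ pphi (he _ e2e); rewrite -normrN in e2e.
    have := cone_ge0 _ _ pphi (he _ e2e).
    rewrite !dotvDr !dotvZr (dotvC _ (delta_mx _ _)) dotv_deltal phip.
    rewrite -[2 / e]invrK invf_div => h1 h2.
    rewrite -[_^-1]mul1r ler_pdivlMr // mulrC -(gtr0_norm e2) -normrM.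
    by rewrite ler_norml; lra.
  apply: closedI; first exact: (closed_psd continuous_moment_map).
  apply: (@closed_comp _ _ (fun phi => dotv phi p) [set 1]).
    by move=> x _; exact: continuous_dotvl.
  exact: closed_eq.
(* Squaring makes the objective positive exactly at invertible moment matrices, whatever the sign of
   the determinant. *)
have [||phi /set_mem[psdphi phip] phimax] :=
    @compact_EVT_max _ _ (fun phi => \det (moment_map phi) ^+ 2) C _ cC.
- exists ((dotv phi0 p)^-1 *: phi0); split => /=.
    rewrite moment_mapZ; apply: psdZ; first by rewrite invr_ge0 ltW.
    exact: posdef_psd.
  by rewrite dotvZl mulVf // gt_eqF.
- apply: continuous_subspaceT.
  have cdet := continuous_det continuous_moment_map.
  by apply: continuous_mulr.
set M := moment_map phi in psdphi phimax.
have detM : 0 < \det M ^+ 2.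
  have d0 : 0 < (dotv phi0 p)^-1 by rewrite invr_gt0.
  apply: lt_le_trans (phimax ((dotv phi0 p)^-1 *: phi0) _); last first.
    rewrite inE; split=> /=; last by rewrite dotvZl mulVf // gt_eqF.
    by rewrite moment_mapZ; apply: psdZ; [exact: ltW|exact: posdef_psd].
  rewrite moment_mapZ detZ lt_def sqr_ge0 andbT sqrf_eq0 mulf_neq0 //.
    by rewrite expf_neq0 // gt_eqF.
  by have := posdef_unit pd0; rewrite unitmxE unitfE.
have uM : M \in unitmx by rewrite unitmxE unitfE -sqrf_eq0 gt_eqF.
have pdM : posdef M by exact: psd_unit_posdef.
pose q := gram_map (invmx M).
(* Along [phi + s psi], which stays in [C] for small [s], the objective is [(det M)^2 P(s)^2] with
   [P(s) = det (1 + s M^-1 moment_map psi)]. Its coefficient [P_1] is a trace, equal to [dotv psi q]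
   by adjointness. *)
have stationary psi : dotv psi p = 0 -> dotv psi q = 0.
  move=> psip; rewrite dotv_gram_map mxtrace_mulC.
  have [P [PE P0 <-]] := det_add1_scale_poly (invmx M *m moment_map psi) N0.
  have [r r0 rP] := posdef_perturb pdM (moment_map_sym psi).
  apply: (coef1_eq0_of_local_max r0 P0) => s /rP pMs.
  rewrite PE -(ler_pM2r detM) mul1r -exprMn mulrC -det_mulmx.
  rewrite mulmxDr mulmx1 -scalemxAr mulKVmx // -moment_mapZ -moment_mapD.
  apply: phimax; rewrite inE; split=> /=.
    by rewrite moment_mapD moment_mapZ.
  by rewrite dotvDl dotvZl psip mulr0 addr0.
have phiq : dotv phi q = N%:R.
  by rewrite dotv_gram_map mulmxV // mxtrace1.
(* Each coordinate functional minus its value at [p] times [phi] vanishes at [p], hence at [q]. *)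
have qE : q = N%:R *: p.
  apply/matrixP => i k; rewrite ord1 mxE -!(dotv_deltal k).
  have := stationary (delta_mx 0 k - dotv (delta_mx 0 k) p *: phi).
  rewrite -scaleNr !dotvDl !dotvZl phip mulr1 subrr => /(_ erefl) /eqP.
  by rewrite mulNr subr_eq0 phiq mulrC => /eqP.
have Nn0 : N%:R != 0 :> R by rewrite pnatr_eq0 -lt0n.
have pdNM : posdef (N%:R *: M).
  split=> [|u un0]; first by rewrite linearZ /= pdM.1.
  by rewrite -scalemxAr -scalemxAl mxE mulr_gt0 ?ltr0n //; exact: pdM.2.
(* Multiplying [phi] by [N] divides the inverse moment matrix by [N], cancelling the factor in
   [q = N p]. *)
exists (N%:R *: phi); rewrite moment_mapZ; split=> //.
rewrite (invmxZ (posdef_unit pdNM)) gram_mapZ -/q qE.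
by rewrite scalerA mulVf // scale1r.
Qed.

End SquaredFunctional.

(** * Degrees of sums of squares, and coordinates of polynomials *)

Section Polynomials.
Variables (R : realType) (n : nat).
Implicit Types p q w : mpoly n R.

Lemma seq_max_mlead (s : seq (mpoly n R)) : s != [::] ->
  exists2 q, q \in s & forall q', q' \in s -> (mlead q' <= mlead q)%O.
Proof.
elim: s => // q [_ _|q1 s /(_ isT)[r rs rmax] _].
  by exists q => [|q']; rewrite inE // => /eqP ->.
have [qr|rq] := leP (mlead q) (mlead r).
  exists r => [|q']; first by rewrite inE rs orbT.
  by rewrite inE => /predU1P[->//|]; exact: rmax.
exists q => [|q']; first by rewrite inE eqxx.
rewrite inE => /predU1P[->//|/rmax q'r]; exact: le_trans q'r (ltW rq).
Qed.

(* Leading terms of squares have positive coefficients, hence do not cancel. *)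
Lemma mdeg_mlead_sum_sqr (s : seq (mpoly n R)) q : q \in s -> q != 0 ->
  (2 * mdeg (mlead q) < mmeasure mdeg (\sum_(p <- s) p ^+ 2))%N.
Proof.
move=> qs q0.
have qs0 : q \in [seq p <- s | p != 0] by rewrite mem_filter q0.
have [|r rs rmax] := @seq_max_mlead [seq p <- s | p != 0].
  by apply: contraTneq qs0 => ->.
move: rs; rewrite mem_filter => /andP[r0 rs].
have smax p : p \in s -> (mlead p <= mlead r)%O.
  have [->|p0 ps] := eqVneq p 0; first by rewrite mlead0 le0x.
  by apply: rmax; rewrite mem_filter p0.
have lead : mnm_add (mlead r) (mlead r) \in msupp (\sum_(p <- s) p ^+ 2).
  rewrite mcoeff_msupp raddf_sum /= big_seq.
  rewrite (eq_bigr (fun p => mcoeff (mlead r) p ^+ 2)); last first.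
    by move=> p ps; rewrite [in LHS]expr2 mleadcMW ?smax // expr2.
  rewrite -big_seq; apply: lt0r_neq0; rewrite lt_def.
  rewrite [X in _ && X]sumr_ge0 ?andbT => [|p _]; last exact: sqr_ge0.
  rewrite psumr_eq0 => [|p _]; last exact: sqr_ge0.
  by apply/allPn; exists r; rewrite // sqrf_eq0 mleadc_eq0.
apply: leq_ltn_trans (msize_mdeg_lt lead).
(* The monomial order refines total degree, so the largest leading monomial also has the largest
   degree. *)
by rewrite mdegD addnn -mul2n leq_mul2l lemc_mdeg ?smax.
Qed.

(** [sos] bounds only the degree of the whole sum, whereas a Gram matrix requires each squared
    polynomial to lie in R[x]_k. *)
Lemma sos_summand_deg k (s : seq (mpoly n R)) q :
  deg_le (2 * k) (\sum_(p <- s) p ^+ 2) -> q \in s -> deg_le k q.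
Proof.
move=> dk qs; rewrite /deg_le; have [->|q0] := eqVneq q 0.
  by rewrite mmeasure0.
have := leq_trans (mdeg_mlead_sum_sqr qs q0) dk.
by rewrite -mlead_deg // !ltnS leq_mul2l.
Qed.

Lemma sum_sqr_eq0 (s : seq (mpoly n R)) q :
  \sum_(p <- s) p ^+ 2 = 0 -> q \in s -> q = 0.
Proof.
move=> s0 qs; apply/eqP/negP => /negP q0.
by have := mdeg_mlead_sum_sqr qs q0; rewrite s0 mmeasure0.
Qed.

Lemma deg_le0 k : deg_le k (0 : mpoly n R).
Proof. by rewrite /deg_le mmeasure0. Qed.

Lemma deg_leD k p q : deg_le k p -> deg_le k q -> deg_le k (p + q).
Proof.
move=> dp dq; apply: leq_trans (mmeasureD_le _ _ _) _.
by rewrite geq_max; apply/andP.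
Qed.

Lemma deg_leZ k a p : deg_le k p -> deg_le k (a *: p).
Proof. by apply: leq_trans; exact: mmeasureZ_le. Qed.

Lemma deg_le_sum k (I : Type) (r : seq I) (P : pred I) (F : I -> mpoly n R) :
  (forall i, P i -> deg_le k (F i)) -> deg_le k (\sum_(i <- r | P i) F i).
Proof.
by move=> dF; elim/big_ind: _ => //; [exact: deg_le0|exact: deg_leD].
Qed.

Lemma deg_leM k l p q : deg_le k p -> deg_le l q -> deg_le (k + l) (p * q).
Proof.
rewrite /deg_le => dp dq; have [->|p0] := eqVneq p 0.
  by rewrite mul0r mmeasure0.
have [->|q0] := eqVneq q 0; first by rewrite mulr0 mmeasure0.
rewrite msizeM // -ltnS prednK; last first.
  by rewrite addn_gt0 lt0n mmeasure_poly_eq0 p0.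
by rewrite -addnS -addSn leq_add.
Qed.

Lemma deg_leX (a : multinom n) : deg_le (mdeg a) (mpolyX R a).
Proof. by rewrite /deg_le mmeasureX. Qed.

Lemma deg_le_trans k l p : (k <= l)%N -> deg_le k p -> deg_le l p.
Proof. by move=> kl dp; apply: leq_trans dp _. Qed.

Lemma deg_le_half_deg p : deg_le (2 * half_deg p) p.
Proof. by rewrite /deg_le /half_deg; lia. Qed.

Lemma mdeg_mon k (i : 'I_(nmon n k)) : (mdeg (mon i) <= k)%N.
Proof. by have := bmdeg (enum_val i); rewrite ltnS. Qed.

Lemma mon_inj k : injective (@mon n k).
Proof. by move=> i j /val_inj/enum_val_inj. Qed.

Lemma sum_bmultinom (V : nmodType) k (F : multinom n -> V) :
  \sum_(b : bmultinom n k.+1) F (bmnm b) = \sum_(i < nmon n k) F (mon i).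
Proof.
rewrite (reindex (fun i : 'I_(nmon n k) => enum_val i)) //=.
by exists enum_rank => x _; rewrite ?enum_valK ?enum_rankK.
Qed.

(** Left inverse of [poly_of_coefs]; terms of degree above [k] are dropped, so it is injective only
    on R[x]_k. *)
Definition coords k w : 'rV[R]_(nmon n k) := \row_i mcoeff (mon i) w.

Lemma coordsD k p q : coords k (p + q) = coords k p + coords k q.
Proof. by apply/matrixP => i j; rewrite !mxE mcoeffD. Qed.

Lemma coordsZ k a p : coords k (a *: p) = a *: coords k p.
Proof. by apply/matrixP => i j; rewrite !mxE mcoeffZ. Qed.

Lemma coords0 k : coords k 0 = 0.
Proof. by apply/matrixP => i j; rewrite !mxE mcoeff0. Qed.

Lemma coords_sum k (I : Type) (r : seq I) (P : pred I) (F : I -> mpoly n R) :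
  coords k (\sum_(i <- r | P i) F i) = \sum_(i <- r | P i) coords k (F i).
Proof. exact: (big_morph _ (@coordsD k) (coords0 k)). Qed.

Lemma coordsK k w : deg_le k w -> poly_of_coefs (coords k w) = w.
Proof.
move=> dw; rewrite [RHS](mpolywE dw).
rewrite (sum_bmultinom k (fun a => mcoeff a w *: mpolyX R a)).
by apply: eq_bigr => i _; rewrite mxE.
Qed.

Lemma poly_of_coefsK k (c : 'rV[R]_(nmon n k)) : coords k (poly_of_coefs c) = c.
Proof.
apply/matrixP => i j; rewrite ord1 mxE /poly_of_coefs raddf_sum (bigD1 j) //=.
rewrite mcoeffZ mcoeffX eqxx mulr1 big1 ?addr0 // => l lj.
by rewrite mcoeffZ mcoeffX (inj_eq (@mon_inj k)) (negPf lj) mulr0.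
Qed.

Lemma deg_le_poly_of_coefs k (c : 'rV[R]_(nmon n k)) :
  deg_le k (poly_of_coefs c).
Proof.
apply: deg_le_sum => i _; apply: deg_leZ.
by apply: deg_le_trans (deg_leX _); exact: mdeg_mon.
Qed.

Definition functional_of_row k (phi : 'rV[R]_(nmon n k)) :
    bmultinom n k.+1 -> R :=
  fun b => phi 0 (enum_rank b).

(** The default value 0 of [seq_ext] agrees with the truncation in [coords]: both sides vanish when
    [a] has degree above [k]. *)
Lemma seq_ext_functional k (phi : 'rV[R]_(nmon n k)) a :
  seq_ext (functional_of_row phi) a = dotv phi (coords k (mpolyX R a)).
Proof.
rewrite dotvE; under eq_bigr do rewrite mxE mcoeffX.
rewrite /seq_ext; case: insubP => [b _ ba|na] /=.
  rewrite (bigD1 (enum_rank b)) //= /mon enum_rankK ba eqxx mulr1.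
  rewrite big1 ?addr0 //.
  move=> i ib; case: eqP => [ai|]; last by rewrite mulr0.
  case/eqP: ib; apply: enum_val_inj.
  by rewrite enum_rankK; apply: val_inj; rewrite ba.
rewrite big1 // => i _; case: eqP => [ai|]; last by rewrite mulr0.
by move: na; rewrite ai ltnS mdeg_mon.
Qed.

Lemma loc_seq_functional k l (phi : 'rV[R]_(nmon n k)) p a : deg_le l p ->
  loc_seq l p (seq_ext (functional_of_row phi)) a =
  dotv phi (coords k (mpolyX R a * p)).
Proof.
move=> dp; rewrite /loc_seq {2}(mpolywE dp) mulr_sumr coords_sum dotv_sumr.
apply: eq_bigr => b _.
by rewrite seq_ext_functional mpolyXD -scalerAr coordsZ dotvZr.
Qed.

End Polynomials.

(** * Principal submatrices and inverses of block matrices *)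

Section MatrixBlocks.
Variable R : realType.

(** Padding [u] with zeros outside the image of [f] gives a vector [v] at which [M] takes the same
    value. *)
Lemma posdef_mxsub N N' (f : 'I_N' -> 'I_N) (M : 'M[R]_N) :
  injective f -> posdef M -> posdef (mxsub f f M).
Proof.
move=> f_inj [sM M0]; split=> [|u un0].
  by apply/matrixP => i j; rewrite !mxE -[in RHS]sM mxE.
pose v : 'cV[R]_N := (rowsub f 1%:M)^T *m u.
have -> : (u^T *m mxsub f f M *m u) 0 0 = (v^T *m M *m v) 0 0.
  rewrite /v trmx_mul trmxK; congr (_ 0 0).
  have -> : mxsub f f M = rowsub f 1%:M *m M *m (rowsub f 1%:M)^T.
    rewrite -rowsubE; apply: trmx_inj; rewrite trmx_mul trmxK -rowsubE.
    by apply/matrixP => i j; rewrite !mxE.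
  by rewrite !mulmxA.
apply: M0; apply: contraNneq un0 => v0; apply/eqP/matrixP => k i.
have /matrixP /(_ (f k) i) := v0; rewrite !mxE (bigD1 k) //= !mxE eqxx mul1r.
rewrite big1 ?addr0 // => l lk.
by rewrite !mxE (inj_eq f_inj) (negPf lk) mul0r.
Qed.

Variables (m : nat) (d : 'I_m -> nat).
Local Notation N := (\sum_j d j)%N.
Local Notation Rank := tagnat.Rank.

Lemma Rank_inj j : injective (@tagnat.Rank m d j).
Proof.
move=> k l /(congr1 val)/eqP.
by rewrite tagnat.eq_Rank eqxx => /eqP/val_inj.
Qed.

Lemma sum_blocks (V : nmodType) (F : 'I_N -> V) :
  \sum_i F i = \sum_j \sum_(k < d j) F (Rank j k).
Proof.
rewrite (reindex (@tagnat.rank m d)) /=; last exact/onW_bij/tagnat.rank_bij.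
by rewrite sig_big_dep; apply: eq_bigr => -[].
Qed.

(** As the rows of block [j] vanish outside that block, the product of the two diagonal blocks is a
    block of [M *m invmx M], so they are inverse to each other. *)
Lemma invmx_block (M : 'M[R]_N) j : M \in unitmx ->
  (forall j' k k', j' != j -> M (Rank j k) (Rank j' k') = 0) ->
  mxsub (Rank j) (Rank j) (invmx M) = invmx (mxsub (Rank j) (Rank j) M).
Proof.
move=> uM Mj; set B := mxsub _ _ (invmx M); set A := mxsub _ _ M.
have AB : A *m B = 1%:M.
  apply/matrixP => k l; have /matrixP /(_ (Rank j k) (Rank j l)) := mulmxV uM.
  rewrite !mxE (inj_eq (@Rank_inj j)) => <-; rewrite sum_blocks (bigD1 j) //=.
  rewrite [X in _ = _ + X]big1 ?addr0 => [|j' j'j]; last first.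
    by rewrite big1 // => k' _; rewrite Mj // mul0r.
  by apply: eq_bigr => k' _; rewrite !mxE.
have uA := (mulmx1_unit AB).1.
by rewrite -[B]mul1mx -(mulVmx uA) -mulmxA AB mulmx1.
Qed.

End MatrixBlocks.

(** * The truncated quadratic module K_t as a Gram cone *)

Section QuadraticModule.
Variables (R : realType) (n m : nat) (g : 'I_m.+1 -> mpoly n R) (t : nat).
Hypothesis ht : forall j, (half_deg (g j) <= t)%N.

Local Notation r j := (t - half_deg (g j))%N.
Local Notation sz := (fun j => nmon n (r j)).
Local Notation Rank := tagnat.Rank.

(** An index is a constraint with a monomial for its multiplier; the value 0 across constraints
    makes the moment matrix block diagonal. *)
Definition block_poly (p p' : {j & 'I_(sz j)}) : mpoly n R :=
  if tag p == tag p'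
  then mpolyX R (mnm_add (mon (tagged p)) (mon (tagged p'))) * g (tag p) else 0.

Definition block_vec (s s' : 'I_(\sum_j sz j)) : 'rV[R]_(nmon n (2 * t)) :=
  coords (2 * t) (block_poly (tagnat.sig s) (tagnat.sig s')).

Lemma deg_le_sqr_mul j p q : deg_le (r j) p -> deg_le (r j) q ->
  deg_le (2 * t) (p * q * g j).
Proof.
move=> dp dq; have d2 := deg_leM (deg_leM dp dq) (deg_le_half_deg (g j)).
by apply: deg_le_trans d2; have := ht j; lia.
Qed.

Lemma deg_le_block_poly p p' : deg_le (2 * t) (block_poly p p').
Proof.
rewrite /block_poly; case: eqP => [e|_]; last exact: deg_le0.
rewrite mpolyXD; apply: deg_le_sqr_mul.
  by apply: deg_le_trans (deg_leX _ _); exact: mdeg_mon.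
by apply: deg_le_trans (deg_leX _ _); rewrite e; exact: mdeg_mon.
Qed.

Lemma block_vec_sym s s' : block_vec s s' = block_vec s' s.
Proof.
rewrite /block_vec /block_poly; move: (tagnat.sig s) (tagnat.sig s').
move=> [j k] [j' k'] /=; rewrite eq_sym; case: eqP => // e.
by move: k k'; rewrite e => k k'; rewrite addmC.
Qed.

Lemma block_poly_Rank j k k' :
  block_poly (tagnat.sig (Rank j k : 'I_(\sum_j sz j)))
             (tagnat.sig (Rank j k' : 'I_(\sum_j sz j)))
  = mpolyX R (mon k) * mpolyX R (mon k') * g j.
Proof. by rewrite /block_poly !tagnat.rankK /= eqxx mpolyXD. Qed.

Lemma block_poly_Rank_neq j j' k k' : j != j' ->
  block_poly (tagnat.sig (Rank j k : 'I_(\sum_j sz j)))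
             (tagnat.sig (Rank j' k' : 'I_(\sum_j sz j)))
  = 0.
Proof. by move=> jj'; rewrite /block_poly !tagnat.rankK /= (negPf jj'). Qed.

(** The sum of the polynomials [(v^T Q_j v) g_j], where [Q_j] is the diagonal block [j] of [Q]. *)
Definition gram_poly (Q : 'M[R]_(\sum_j sz j)) : mpoly n R :=
  \sum_j \sum_k \sum_k' Q (Rank j k) (Rank j k') *:
    (mpolyX R (mon k) * mpolyX R (mon k') * g j).

Lemma gram_map_coords Q : gram_map block_vec Q = coords (2 * t) (gram_poly Q).
Proof.
rewrite /gram_map sum_blocks coords_sum; apply: eq_bigr => j _.
rewrite coords_sum; apply: eq_bigr => k _.
rewrite coords_sum sum_blocks (bigD1 j) //= [X in _ + X]big1 ?addr0.
  by apply: eq_bigr => k' _; rewrite coordsZ /block_vec block_poly_Rank.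
move=> j' j'j; rewrite big1 // => k' _.
by rewrite /block_vec block_poly_Rank_neq ?coords0 ?scaler0 // eq_sym.
Qed.

Definition block_row (u : 'cV[R]_(\sum_j sz j)) j : 'rV[R]_(sz j) :=
  \row_k u (Rank j k) 0.

Lemma gram_poly_rank1 u :
  gram_poly (u *m u^T) = \sum_j poly_of_coefs (block_row u j) ^+ 2 * g j.
Proof.
apply: eq_bigr => j _; rewrite expr2 /poly_of_coefs !mulr_suml.
apply: eq_bigr => k _; rewrite mulr_sumr mulr_suml; apply: eq_bigr => k' _.
by rewrite mxE big_ord1 !mxE -!scalerAl -scalerAr -scalerAl scalerA.
Qed.

Lemma block_row_eq0 u : (forall j, poly_of_coefs (block_row u j) = 0) -> u = 0.
Proof.
move=> u0; apply/matrixP => s i; rewrite ord1 mxE -[s]tagnat.sig2K.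
have := congr1 (@coords R n (r (tagnat.sig1 s))) (u0 (tagnat.sig1 s)).
rewrite poly_of_coefsK coords0.
by move=> /matrixP /(_ 0 (tagnat.sig2 s)); rewrite !mxE.
Qed.

Lemma gram_cone_sum (I : eqType) (s : seq I)
    (F : I -> 'rV[R]_(nmon n (2 * t))) :
  (forall i, i \in s -> gram_cone block_vec (F i)) ->
  gram_cone block_vec (\sum_(i <- s) F i).
Proof.
elim: s => [_|i s IH hF].
  rewrite big_nil; exists 0; first exact: psd0.
  by have := gram_mapZ block_vec 0 0; rewrite !scale0r.
rewrite big_cons; have [Q pQ ->] := hF i (mem_head _ _).
have [|Q' pQ' ->] := IH; first by move=> k ks; apply: hF; rewrite inE ks orbT.
by exists (Q + Q'); rewrite ?gram_mapD //; exact: psdD.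
Qed.

Lemma gram_cone_sqr j q : deg_le (r j) q ->
  gram_cone block_vec (coords (2 * t) (q ^+ 2 * g j)).
Proof.
(* [u] is the coefficient vector of [q] placed in block [j], with zeros in the other blocks. *)
move=> dq; pose u : 'cV[R]_(\sum_j sz j) :=
  \col_s (if tagnat.sig1 s == j then mcoeff (mon (tagnat.sig2 s)) q else 0).
exists (u *m u^T); first exact: psd_rank1.
rewrite gram_map_coords gram_poly_rank1; congr coords.
have uE j' : block_row u j' = if j' == j then coords (r j') q else 0.
  apply/matrixP => i k.
  rewrite ord1 !mxE /tagnat.sig1 /tagnat.sig2 tagnat.rankK /=.
  by case: eqP => _; rewrite !mxE.
rewrite (bigD1 j) //= uE eqxx coordsK // big1 ?addr0 // => j' j'j.
rewrite uE (negPf j'j) -(coords0 _) coordsK ?expr0n ?mul0r //; exact: deg_le0.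
Qed.

(** Each [sigma j] splits into squares of polynomials of bounded degree, and each square times [g j]
    has a rank one Gram matrix. The inclusion passes to interiors. *)
Lemma qcone_sub_gram_cone :
  @poly_of_coefs R n (2 * t) @^-1` qcone g t `<=` gram_cone block_vec.
Proof.
move=> c /= [sigma [sigma_sos cE]]; rewrite -(poly_of_coefsK c) cE coords_sum.
apply: gram_cone_sum => j _; have [dj [s sE]] := sigma_sos j.
rewrite sE mulr_suml coords_sum; apply: gram_cone_sum => q qs.
by apply: gram_cone_sqr; apply: sos_summand_deg qs; rewrite -sE.
Qed.

(** If the terms [sigma j * g j] add up to 0, the opposite of each is the sum of the others, so
    pointedness makes each zero. Then [sigma j = 0] as [g j != 0], and a vanishing sum of squares
    kills every vector in the decomposition of [Q], off-diagonal blocks included. *)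
Lemma pointed_gram_map_eq0 : (forall j, g j != 0) -> pointed (qcone g t) ->
  forall Q, psd Q -> gram_map block_vec Q = 0 -> Q = 0.
Proof.
move=> g0 K_pointed Q /psd_sum_rank1[s ->] /[1!gram_map_coords] h.
pose sigma j := \sum_(u <- s) poly_of_coefs (block_row u j) ^+ 2.
have sumE : gram_poly (\sum_(u <- s) u *m u^T) = \sum_j sigma j * g j.
  rewrite (_ : gram_poly _ = \sum_(u <- s) gram_poly (u *m u^T)).
    rewrite (eq_bigr _ (fun u _ => gram_poly_rank1 u)).
    by rewrite exchange_big; apply: eq_bigr => j _; rewrite mulr_suml.
  rewrite /gram_poly [RHS]exchange_big; apply: eq_bigr => j _.
  rewrite [RHS]exchange_big; apply: eq_bigr => k _.
  rewrite [RHS]exchange_big; apply: eq_bigr => k' _.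
  by rewrite summxE scaler_suml.
have dgsigma j : deg_le (2 * t) (sigma j * g j).
  rewrite mulr_suml; apply: deg_le_sum => u _; rewrite expr2.
  by apply: deg_le_sqr_mul; exact: deg_le_poly_of_coefs.
have sum0 : \sum_j sigma j * g j = 0.
  rewrite -sumE -(coordsK (k := 2 * t) (w := gram_poly _)) ?h.
    by rewrite -(coords0 R n (2 * t)) coordsK //; exact: deg_le0.
  by rewrite sumE; exact: deg_le_sum.
have sos0 k : sos k (0 : mpoly n R).
  by split; [exact: deg_le0|exists [::]; rewrite big_nil].
have sos_sigma j : sos (r j) (sigma j).
  split; last first.
    by exists [seq poly_of_coefs (block_row u j) | u <- s]; rewrite big_map.
  apply: deg_le_sum => u _; rewrite mul2n -addnn expr2.
  by apply: deg_leM; exact: deg_le_poly_of_coefs.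
have sigma0 j : sigma j = 0.
  have : sigma j * g j = 0.
    apply: K_pointed.
      exists (fun i => if i == j then sigma j else 0); split=> [i|].
        by case: eqP => [->|_].
      rewrite (bigD1 j) //= eqxx big1 ?addr0 // => i ij.
      by rewrite (negPf ij) mul0r.
    exists (fun i => if i == j then 0 else sigma i); split=> [i|].
      by case: eqP.
    move: sum0; rewrite (bigD1 j) //= => /eqP; rewrite addr_eq0 => /eqP ->.
    rewrite opprK [RHS](bigD1 j) //= eqxx mul0r add0r.
    by apply: eq_bigr => i ij; rewrite (negPf ij).
  by move/eqP; rewrite mulf_eq0 (negPf (g0 j)) orbF => /eqP.
apply: big1_seq => u /andP[_ us].
rewrite (block_row_eq0 (u := u)) ?mul0mx // => j.
have := sigma0 j; rewrite /sigma -(big_map _ predT (fun p => p ^+ 2)).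
by move/sum_sqr_eq0; apply; apply: map_f.
Qed.

Lemma nmon_gt0 k : (0 < nmon n k)%N.
Proof. by apply/card_gt0P; exists bm0. Qed.

(** The diagonal blocks of the moment matrix are the localized moment matrices, and those of its
    inverse are their inverses. The image of the inverse under [gram_map] is thus the Christoffel
    sum. *)
Theorem qcone_interior_christoffel (d : 'I_m.+1 -> nat) p :
  (forall j, deg_le (d j) (g j)) -> (forall j, g j != 0) ->
  pointed (qcone g t) -> interior_deg (2 * t) (qcone g t) p ->
  exists phi : bmultinom n (2 * t).+1 -> R,
    (forall j, posdef (moment_mx (r j) (loc_seq (d j) (g j) (seq_ext phi)))) /\
    (forall x : 'I_n -> R, meval x p =
       \sum_j (christoffel (r j) (loc_seq (d j) (g j) (seq_ext phi)) x)^-1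
              * meval x (g j)).
Proof.
move=> dg g0 K_pointed [c c_int <-].
have [||phi [pd pE]] := interior_gram_cone (p := c) block_vec_sym
    (pointed_gram_map_eq0 g0 K_pointed).
(* The constant monomial of the first block makes the matrix nonempty. *)
- by rewrite (bigD1 ord0) //= addn_gt0 nmon_gt0.
- exact: (interiorS qcone_sub_gram_cone).
set M := moment_map block_vec phi in pd pE.
have subM j : mxsub (Rank j) (Rank j) M =
    moment_mx (r j) (loc_seq (d j) (g j) (seq_ext (functional_of_row phi))).
  apply/matrixP => k k'; rewrite !mxE (loc_seq_functional _ _ (dg j)).
  by rewrite /block_vec block_poly_Rank mpolyXD.
exists (functional_of_row phi); split=> [j|x].
  by rewrite -subM; apply: posdef_mxsub => //; exact: Rank_inj.
rewrite -pE gram_map_coords coordsK; last first.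
  apply: deg_le_sum => j _; apply: deg_le_sum => k _; apply: deg_le_sum => k' _.
  by apply: deg_leZ; rewrite -block_poly_Rank; exact: deg_le_block_poly.
rewrite raddf_sum; apply: eq_bigr => j _; rewrite /christoffel invrK -subM.
rewrite -invmx_block; last 2 first.
- exact: posdef_unit.
- move=> j' k k' j'j; rewrite mxE /block_vec block_poly_Rank_neq 1?eq_sym //.
  by rewrite coords0 /dotv trmx0 mulmx0 mxE.
rewrite qformE raddf_sum mulr_suml; apply: eq_bigr => k _ /=.
rewrite raddf_sum mulr_suml; apply: eq_bigr => k' _ /=.
by rewrite !mxE mevalZ !mevalM !mulrA; congr (_ * _ * _); exact: mulrC.
Qed.

End QuadraticModule.

(** Both assumptions of the second part are necessary: [g j = 0] gives a zero moment matrix, and a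
    functional with positive definite moment matrices is positive on all nonzero elements of the
    cone, which excludes opposite pairs. *)
Theorem lemma2p4 (R : realType) (n m : nat) (d : 'I_m.+1 -> nat)
    (g : 'I_m.+1 -> mpoly n R) (hg : forall j, deg_le (d j) (g j))
    (t : nat) (ht : forall j, (half_deg (g j) <= t)%N)
    (p : mpoly n R) (hp : interior_deg (2 * t) (qcone g t) p) :
  (forall x : 'I_n -> R,
     (forall j, 0 <= meval x (g j)) -> 0 <= meval x p) /\
  ((forall j, g j != 0) -> pointed (qcone g t) ->
   exists phi : bmultinom n (2 * t).+1 -> R,
     (forall j, posdef (moment_mx (t - half_deg (g j))
                          (loc_seq (d j) (g j) (seq_ext phi)))) /\
     (forall x : 'I_n -> R,
        meval x p =
        \sum_j (christoffel (t - half_deg (g j))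
                  (loc_seq (d j) (g j) (seq_ext phi)) x)^-1
               * meval x (g j))).
Proof.
split=> [x xS|g0 K_pointed]; last exact: qcone_interior_christoffel.
have [c /interior_subset[sigma [sigma_sos ->]] <-] := hp.
rewrite raddf_sum; apply: sumr_ge0 => j _ /=; rewrite mevalM mulr_ge0 //.
have [_ [s ->]] := sigma_sos j; rewrite raddf_sum; apply: sumr_ge0 => q _ /=.
by rewrite rmorphXn /= sqr_ge0.
Qed.
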